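(* Let $G=(V,E)$ be a finite graph, $Q\in\mathbb{R}^V$, $H_Q=\Delta_G+Q$ and $T>0$. If $H_Q$ has an eigenvalue of multiplicity at least $2$, then $H_Q$ fails to do phase retrieval: there exist $u_0,v_0\in\mathbb{C}^V$ with $|(e^{-itH_Q}u_0)(j)|=|(e^{-itH_Q}v_0)(j)|$ for all $t\in[0,T]$ and $j\in V$, but such that there is no $c\in\mathbb{C}$ with $|c|=1$ and $v_0=c\,u_0$.
   Context: $G=(V,E)$ is a finite simple undirected graph. Its combinatorial Laplacian is $\Delta_G u(j)=\sum_{k\sim j}(u(j)-u(k))$. A potential $Q\in\mathbb{R}^V$ is identified with the diagonal operator $(Qu)(j)=Q(j)u(j)$. *)

(* Defs.v *)
From HB Require Import structures.
From mathcomp Require Import all_boot all_order all_algebra.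
From mathcomp Require Export complex.
From mathcomp Require Import classical_sets reals topology normedtype sequences.

Set Implicit Arguments.
Unset Strict Implicit.
Unset Printing Implicit Defensive.

Import Order.TTheory GRing.Theory Num.Theory.
Import numFieldNormedType.Exports.

Local Open Scope classical_set_scope.
Local Open Scope ring_scope.
Local Open Scope complex_scope.

(* C^V.  The codomain is the regular algebra R[i]^o so that the function space
   is a vectType over R[i], and R[i] carries its norm topology. *)
Definition state (R : realType) (V : finType) := {ffun V -> R[i]^o}.

HB.instance Definition _ (R : realType) (V : finType) :=
  Vector.copy (state R V) {ffun V -> R[i]^o}.

Section Operators.
Context {R : realType} {V : finType}.
Implicit Types (e : rel V) (Q : V -> R) (u : state R V).

Definition laplacian_fun e u : state R V :=
  [ffun j => \sum_(k | e j k) (u j - u k)].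

Lemma laplacian_fun_is_linear e : linear (laplacian_fun e).
Proof.
move=> a u v; apply/ffunP => j; rewrite !ffunE scaler_sumr -big_split /=.
by apply: eq_bigr => k _; rewrite !ffunE scalerBr opprD addrACA.
Qed.

HB.instance Definition _ e :=
  GRing.isLinear.Build R[i] (state R V) (state R V) *:%R
    (laplacian_fun e) (laplacian_fun_is_linear e).

Definition laplacian e : 'End(state R V) := linfun (laplacian_fun e).

Definition potential_fun Q u : state R V := [ffun j => (Q j)%:C * u j].

Lemma potential_fun_is_linear Q : linear (potential_fun Q).
Proof.
move=> a u v; apply/ffunP => j; rewrite !ffunE mulrDr; congr (_ + _).
by rewrite -[LHS]/(_ * (a * _)) mulrCA.
Qed.

HB.instance Definition _ Q :=
  GRing.isLinear.Build R[i] (state R V) (state R V) *:%R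
    (potential_fun Q) (potential_fun_is_linear Q).

Definition potential Q : 'End(state R V) := linfun (potential_fun Q).

Definition hamiltonian e Q : 'End(state R V) := laplacian e + potential Q.

Lemma laplacianE e u j : laplacian e u j = \sum_(k | e j k) (u j - u k).
Proof. by rewrite lfunE ffunE. Qed.

Lemma potentialE Q u j : potential Q u j = (Q j)%:C * u j.
Proof. by rewrite lfunE ffunE. Qed.

(* e^A u = \sum_k A^k u / k!, the sum being taken at each vertex (on the
   finite-dimensional space C^V this is convergence in norm). *)
Definition expop (A : 'End(state R V)) u : state R V :=
  [ffun j => limn (series (fun k => ((k`!)%:R^-1 : R[i]) *: iter k A u j))].

(* e^{-itH} u *)
Definition evolution (H : 'End(state R V)) (t : R) u : state R V :=
  expop ((- ('i%C * t%:C)) *: H) u.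

End Operators.

(* Main.v *)
Require Import Defs.
From mathcomp Require Import all_boot all_order all_algebra.
From mathcomp Require Import boolp classical_sets reals topology normedtype.
From mathcomp Require Import sequences.

(** A real symmetric operator has real eigenvalues, so each of its eigenspaces
    is stable under complex conjugation. The evolution of an eigenvector [u] is
    a scalar multiple of [u], hence [u] and its conjugate have pointwise equal
    moduli at all times. They cannot be proportional for every [u] in an
    eigenspace containing independent [f] and [g]: if [conj f = a f] and
    [conj g = b g], then proportionality for [f + g] gives [a = b] and for
    [f + i g] gives [a = - b], so that [a = 0]. *)

Import GRing.Theory Num.Theory.

Local Open Scope ring_scope.

Section PhaseRetrieval.
Context {R : realType} {V : finType}.
Implicit Types (e : rel V) (Q : V -> R) (u v f g : state R V) (mu : R[i]).

Definition conj_state u : state R V := [ffun j => (u j : R[i])^*].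

Lemma conj_stateD u v : conj_state (u + v) = conj_state u + conj_state v.
Proof. by apply/ffunP => j; rewrite !ffunE rmorphD. Qed.

Lemma conj_stateZ mu u : conj_state (mu *: u) = mu^* *: conj_state u.
Proof. by apply/ffunP => j; rewrite !ffunE -[RHS]/(_ * _) -rmorphM. Qed.

Lemma hamiltonianE e Q u j :
  hamiltonian e Q u j = \sum_(k | e j k) (u j - u k) + (Q j)%:C%C * u j.
Proof. by rewrite /hamiltonian add_lfunE ffunE laplacianE potentialE. Qed.

(** The coefficients of [hamiltonian e Q] in the vertex basis are real. *)
Lemma hamiltonian_conj e Q u :
  hamiltonian e Q (conj_state u) = conj_state (hamiltonian e Q u).
Proof.
apply/ffunP => j; rewrite hamiltonianE [RHS]ffunE hamiltonianE !ffunE.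
rewrite rmorphD rmorphM rmorph_sum /=; congr (_ + _ * _).
  by apply: eq_bigr => k _; rewrite ffunE rmorphB.
exact/esym/conjc_real.
Qed.

Lemma hamiltonian_sym e Q u v : symmetric e ->
  \sum_j u j * hamiltonian e Q v j = \sum_j hamiltonian e Q u j * v j :> R[i].
Proof.
move=> e_sym.
under eq_bigr => j _ do rewrite hamiltonianE mulrDr mulr_sumr.
under [RHS]eq_bigr => j _ do rewrite hamiltonianE mulrDl mulr_suml.
rewrite !big_split /=; congr (_ + _); last first.
  by apply: eq_bigr => j _; rewrite mulrCA mulrA.
under eq_bigr => j _ do (under eq_bigr => k _ do rewrite mulrBr; rewrite big_split).
under [RHS]eq_bigr => j _ do (under eq_bigr => k _ do rewrite mulrBl; rewrite big_split).
rewrite !big_split /=; congr (_ + _).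
(* Only the cross terms [u j * v k] over edges remain; swapping the indices matches them, and
   symmetry of [e] keeps the range. *)
rewrite (exchange_big_dep predT) //=.
apply: eq_bigr => j _; apply: eq_bigl => k; exact: e_sym.
Qed.

(** The symmetric form is bilinear, so pairing [conj_state u] with [u] yields the Hermitian square
    norm, multiplied by [mu] on one side and by [mu^*] on the other. *)
Lemma hamiltonian_eigenvalue_real {e Q mu u} : symmetric e -> u != 0 ->
  hamiltonian e Q u = mu *: u -> mu^* = mu.
Proof.
move=> e_sym u0 Hu.
have := hamiltonian_sym e Q (conj_state u) u e_sym.
rewrite hamiltonian_conj Hu conj_stateZ.
under eq_bigr => j _ do rewrite ffunE [(mu *: u) j]ffunE -[mu *: u j]/(mu * u j) mulrCA.
under [RHS]eq_bigr => j _ do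
  rewrite ffunE [conj_state u j]ffunE -[mu^* *: _]/(mu^* * _) -mulrA.
rewrite -!mulr_sumr => /esym; apply: mulIf; apply: contra u0.
rewrite psumr_eq0 => [/allP /= N0|j _]; last by rewrite mulrC mul_conjC_ge0.
apply/eqP/ffunP => j; rewrite ffunE; apply/eqP.
by have := N0 j (mem_index_enum j); rewrite mulrC mul_conjC_eq0.
Qed.

(* A divergent sequence has the same junk limit as its multiples by a nonzero
   scalar, so convergence of the exponential series is never needed. *)
Lemma norm_limn_unit_scale (w : R[i]) (s : nat -> R[i]^o) : `|w| = 1 ->
  `|limn (fun n => w *: s n) : R[i]^o| = `|limn s|.
Proof.
move=> w1; have w0 : w != 0 by rewrite -normr_eq0 w1 oner_eq0.
have [cs|ds] := pselect (cvgn s).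
  by rewrite (limZl_tmp w cs) normrZ w1 mul1r.
have wds : ~ cvgn (fun n => w *: s n) by rewrite (is_cvgZlE s w0).
by rewrite (dvgP ds) (dvgP wds).
Qed.

(** At the vertex [j] the terms of the two series are [mu ^+ k / k!] times [u j] and [v j], so the
    series differ by one unimodular factor [w], which may depend on [j]. *)
Lemma expop_eigen_norm {A : 'End(state R V)} {mu u v} j :
  A u = mu *: u -> A v = mu *: v -> `|u j| = `|v j| ->
  `|expop A u j| = `|expop A v j|.
Proof.
move=> Au Av uv.
have iterE x k : A x = mu *: x -> iter k A x = mu ^+ k *: x.
  move=> Ax; elim: k => [|k IH]; first by rewrite expr0 scale1r.
  by rewrite iterS IH linearZ /= Ax scalerA -exprSr.
have [w w1 vE] : exists2 w : R[i], `|w| = 1 & v j = w *: u j.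
  have [u0|u0] := eqVneq (u j) 0.
    exists 1; first exact: normr1.
    by move/eqP: uv; rewrite u0 normr0 eq_sym normr_eq0 => /eqP ->; rewrite scaler0.
  exists ((v j : R[i]) / u j); first by rewrite normf_div -uv divff ?normr_eq0.
  by rewrite -[_ *: _]/(_ * _) divfK.
rewrite !ffunE -(norm_limn_unit_scale w _ w1); congr `|limn _|.
apply/funext => n; rewrite /series /= scaler_sumr.
apply: eq_bigr => k _; rewrite !iterE // !ffunE vE !scalerA.
by congr (_ *: _); rewrite -mulrA mulrC.
Qed.

Lemma evolution_eigen_norm {H : 'End(state R V)} {mu u v} t j :
  H u = mu *: u -> H v = mu *: v -> `|u j| = `|v j| ->
  `|evolution H t u j| = `|evolution H t v j|.
Proof.
move=> Hu Hv; apply: (@expop_eigen_norm _ (- ('i%C * t%:C%C) * mu)).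
- by rewrite scale_lfunE Hu scalerA.
- by rewrite scale_lfunE Hv scalerA.
Qed.

(** Every scalar [c] is excluded, not only unimodular ones; [c = 0] thus shows that the combination
    is nonzero. *)
Lemma free_pair_nonproportional_conj f g :
  (forall a b : R[i], a *: f + b *: g = 0 -> a = 0 /\ b = 0) ->
  exists z w : R[i],
    let u := z *: f + w *: g in ~ exists c : R[i], conj_state u = c *: u.
Proof.
move=> fg; apply: contrapT => nex.
have prop z w : exists c : R[i],
    conj_state (z *: f + w *: g) = c *: (z *: f + w *: g).
  by apply: contrapT => h; apply: nex; exists z, w.
have [a] := prop 1 0; have [b] := prop 0 1.
rewrite !scale1r !scale0r addr0 add0r => gb fa.
(* Conjugation is antilinear, so independence of [f] and [g] allows comparing coefficients. *)
have coef z w : exists c : R[i], z^* * a = c * z /\ w^* * b = c * w.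
  have [c] := prop z w; rewrite conj_stateD !conj_stateZ fa gb (scalerDr c) !scalerA => h.
  exists c.
  have [/eqP + /eqP +] : z^* * a - c * z = 0 /\ w^* * b - c * w = 0.
    apply: fg; rewrite !scalerBl addrACA -opprD; apply/eqP.
    by rewrite subr_eq0; apply/eqP.
  by move: h => _; rewrite !subr_eq0 => /eqP -> /eqP ->.
have ba : b = a.
  by have [c] := coef 1 1; rewrite conjC1 !mul1r !mulr1 => -[-> ->].
have a0 : a = 0.
  (* Here [c = a] and [- 'i * a = a * 'i], hence [2 a = 0]. *)
  have [c] := coef 1 'i; rewrite conjC1 conjCi mul1r mulr1 ba => -[<- /eqP].
  rewrite mulNr mulrC eq_sym -addr_eq0 -mulr2n mulrn_eq0 mulf_eq0 (negPf (neq0Ci _)) orbF.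
  by move=> /eqP.
have : f = 0.
  apply/ffunP => j; move/ffunP/(_ j): fa; rewrite a0 scale0r !ffunE.
  by move/eqP; rewrite conjC_eq0 => /eqP.
move=> f0; have [] := fg 1 0; first by rewrite f0 scaler0 scale0r addr0.
by move/eqP; rewrite oner_eq0.
Qed.

End PhaseRetrieval.

(** A nonzero vector of [U] spans only a line, so [U] contains some [g] off that line. *)
Lemma dim_ge2_free_pair (K : fieldType) (vT : vectType K) (U : {vspace vT}) :
  (2 <= \dim U)%N -> exists f g, [/\ f \in U, g \in U &
    forall a b : K, a *: f + b *: g = 0 -> a = 0 /\ b = 0].
Proof.
move=> dU; have f0 : vpick U != 0 by rewrite vpick0 -dimv_eq0 -lt0n (ltnW dU).
have /subvPn[g gU gf] : ~~ (U <= <[vpick U]>)%VS.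
  by apply/negP => /dimvS; rewrite dim_vline f0 leqNgt dU.
exists (vpick U), g; split => // [|a b h]; first exact: memv_pick.
have b0 : b = 0.
  apply/eqP; apply: contraNT gf => b0; apply/vlineP; exists (- (b^-1 * a)).
  rewrite scaleNr -scalerA; apply/eqP; rewrite -addr_eq0; apply/eqP.
  apply: (scalerI b0); rewrite scalerDr scaler0 !scalerA mulrA divff //.
  by rewrite mul1r addrC.
split=> //; move/eqP: h; rewrite b0 scale0r addr0 scaler_eq0 (negPf f0) orbF.
by move/eqP.
Qed.

Theorem mainTheorem11 (R : realType) (V : finType) (e : rel V)
    (esym : symmetric e) (eirr : irreflexive e) (Q : V -> R) (T : R)
    (hT : 0 < T)
    (hmult : exists lambda : R[i],
      (2 <= \dim (passmx.leigenspace (hamiltonian e Q) lambda))%N) :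
  exists u0 v0 : state R V,
    (forall (t : R) (j : V), 0 <= t <= T ->
       `|evolution (hamiltonian e Q) t u0 j|
       = `|evolution (hamiltonian e Q) t v0 j|) /\
    ~ (exists c : R[i], `|c| = 1 /\ v0 = c *: u0).
Proof.
have [mu /dim_ge2_free_pair[f [g [fE gE fg]]]] := hmult.
have eigE u : u \in passmx.leigenspace (hamiltonian e Q) mu ->
    hamiltonian e Q u = mu *: u.
  rewrite memv_ker add_lfunE opp_lfunE scale_lfunE id_lfunE subr_eq0.
  by move/eqP.
have [z [w nprop]] := free_pair_nonproportional_conj _ _ fg.
set u := z *: f + w *: g in nprop.
have Hu : hamiltonian e Q u = mu *: u.
  by apply: eigE; rewrite memvD ?memvZ.
have u0 : u != 0.
  apply/eqP => u0; apply: nprop; exists 0.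
  by rewrite u0 scale0r; apply/ffunP => j; rewrite !ffunE conjC0.
clearbody u; exists u, (conj_state u); split; last by move=> [c [_ h]]; apply: nprop; exists c.
(* The conjugate of [u] has eigenvalue [mu^*], which equals [mu]. *)
move=> t j _; apply: (evolution_eigen_norm t j Hu).
  rewrite hamiltonian_conj Hu conj_stateZ.
  rewrite (hamiltonian_eigenvalue_real esym u0 Hu).
  reflexivity.
rewrite ffunE; symmetry; exact: norm_conjC.
Qed.
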